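(* Let $n \ge 29$ be an integer with $n \equiv 1 \pmod 4$. Then $T(n) = \frac{3}{2}n + \frac{3}{2}$.
   Context: A (burnt) stack of $n$ pancakes is a sequence $[x_1,\dots,x_n]$, read from top to bottom, of nonzero integers such that $|x_1|,\dots,|x_n|$ is a permutation of $1,\dots,n$; a negative sign means that the burnt side of the pancake is face-up. For $1\le k\le n$, the flip $(k)$ transforms $[x_1,\dots,x_n]$ into $[-x_k,-x_{k-1},\dots,-x_1,x_{k+1},\dots,x_n]$. Let $I_n=[1,2,\dots,n]$ (the sorted stack) and $\overline{I_n}=[-1,-2,\dots,-n]$. $T(n)$ denotes the minimum number of flips required to transform $\overline{I_n}$ into $I_n$. *)

(* Defs.v *)
From mathcomp Require Import all_boot all_order all_algebra.

Set Implicit Arguments.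
Unset Strict Implicit.
Unset Printing Implicit Defensive.

Import GRing.Theory.

(* The entries of a stack are nonzero, since iota 1 n = [:: 1; ...; n]. *)
Definition is_stack (n : nat) (s : seq int) : bool :=
  perm_eq [seq `|x|%N | x <- s] (iota 1 n).

(* flip k [:: x_1; ...; x_n] = [:: - x_k; ...; - x_1; x_(k+1); ...; x_n],
   meant for 1 <= k <= n; the range of k is imposed in [transforms_in]. *)
Definition flip (k : nat) (s : seq int) : seq int :=
  [seq (- x)%R | x <- rev (take k s)] ++ drop k s.

Definition flips (ks : seq nat) (s : seq int) : seq int :=
  foldl (fun t k => flip k t) s ks.

Definition sorted_stack (n : nat) : seq int := [seq Posz i | i <- iota 1 n].

Definition burnt_stack (n : nat) : seq int := [seq (- Posz i)%R | i <- iota 1 n].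

Lemma sorted_stackP n : is_stack n (sorted_stack n).
Proof. by rewrite /is_stack /sorted_stack -map_comp (@eq_map _ _ _ id) ?map_id. Qed.

Lemma burnt_stackP n : is_stack n (burnt_stack n).
Proof.
rewrite /is_stack /burnt_stack -map_comp (@eq_map _ _ _ id) ?map_id //.
by move=> i; apply: (abszN (Posz i)).
Qed.

Lemma flip_stack n k s : is_stack n s -> is_stack n (flip k s).
Proof.
apply: perm_trans; rewrite /flip map_cat -map_comp.
rewrite (@eq_map _ _ (absz \o -%R)%R absz abszN).
by rewrite map_rev -{3}(cat_take_drop k s) map_cat perm_cat2r perm_rev.
Qed.

(* The flip sizes 1 <= k <= n are encoded in 'I_n.+1, so that the predicate
   is boolean, as ex_minn requires; see [transforms_inP]. *)
Definition transforms_in (n m : nat) (s t : seq int) : bool :=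
  [exists ks : m.-tuple 'I_n.+1,
    all (fun k => 0 < k) (map val ks) && (flips (map val ks) s == t)].

Lemma transforms_inP n m s t :
  reflect (exists ks : seq nat, [/\ size ks = m,
             all (fun k => 0 < k <= n) ks & flips ks s = t])
          (transforms_in n m s t).
Proof.
apply: (iffP existsP) => [[ks /andP[pos /eqP eq_t]]|[ks [sz_ks ok eq_t]]].
  exists (map val ks); split=> //; first by rewrite size_map size_tuple.
  apply/allP => k kks; rewrite (allP pos k kks) /=.
  by case/mapP: kks => i _ ->; rewrite -ltnS ltn_ord.
have sz : size (map (@inord n) ks) == m by rewrite size_map sz_ks.
exists (Tuple sz) => /=.
have -> : map val (map (@inord n) ks) = ks.
  rewrite -map_comp map_id_in // => k /(allP ok) /andP[_ le_kn] /=.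
  by rewrite inordK.
by rewrite eq_t eqxx andbT; apply: sub_all ok => k /andP[].
Qed.

Lemma flips_cat ks1 ks2 s : flips (ks1 ++ ks2) s = flips ks2 (flips ks1 s).
Proof. exact: foldl_cat. Qed.

(* The flips (k), (1), (k) turn over the k-th pancake only. *)
Lemma flips_turn s1 x s2 :
  flips [:: (size s1).+1; 1; (size s1).+1] (s1 ++ x :: s2)
  = s1 ++ (- x)%R :: s2.
Proof.
rewrite /flips /=.
have flipE t : flip (size t) (t ++ s2) = [seq (- y)%R | y <- rev t] ++ s2.
  by rewrite /flip take_size_cat // drop_size_cat.
have e : forall y, s1 ++ y :: s2 = rcons s1 y ++ s2 by move=> y; rewrite cat_rcons.
rewrite !e -(size_rcons s1 x) flipE rev_rcons /=.
have flip1 y t : flip 1 (y :: t) = (- y)%R :: t by rewrite /flip /= take0 drop0.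
rewrite flip1 opprK.
have -> : size (rcons s1 x) = size (x :: [seq (- y)%R | y <- rev s1]).
  by rewrite size_rcons /= size_map size_rev.
rewrite -cat_cons flipE rev_cons map_rcons -map_rev revK -map_comp.
by rewrite (@eq_map _ _ _ id) ?map_id // => y /=; rewrite opprK.
Qed.

Lemma burnt_sortable n :
  exists m, transforms_in n m (burnt_stack n) (sorted_stack n).
Proof.
suff [ks ok eq_n] : exists2 ks, all (fun k => 0 < k <= n) ks &
    flips ks (burnt_stack n) = sorted_stack n.
  by exists (size ks); apply/transforms_inP; exists ks.
suff H j : j <= n -> exists2 ks, all (fun k => 0 < k <= n) ks &
    flips ks (burnt_stack n)
    = sorted_stack j ++ [seq (- Posz i)%R | i <- iota j.+1 (n - j)].
  by have [ks ok] := H n (leqnn n); rewrite subnn cats0; exists ks.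
elim: j => [_|j IH lt_jn]; first by exists [::] => //; rewrite subn0.
have [ks ok eq_j] := IH (ltnW lt_jn).
exists (ks ++ [:: j.+1; 1; j.+1]).
  by rewrite all_cat ok /= lt_jn (leq_trans _ lt_jn).
have sz_j : size (sorted_stack j) = j by rewrite size_map size_iota.
rewrite flips_cat eq_j -(subnSK lt_jn).
have := flips_turn (sorted_stack j) (- Posz j.+1)%R
  [seq (- Posz i)%R | i <- iota j.+2 (n - j.+1)].
rewrite sz_j opprK => eq_j1; apply: etrans eq_j1 _.
have iota_j : iota 1 j.+1 = iota 1 j ++ [:: j.+1]
  by have := iotaD 1 j 1; rewrite addn1 add1n.
by rewrite /sorted_stack iota_j map_cat -catA.
Qed.

Definition T (n : nat) : nat := ex_minn (burnt_sortable n).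

(* Main.v *)
Require Import Defs.
From mathcomp Require Import all_boot all_order all_algebra.
From mathcomp Require Import zify lra.

(** Call two neighbouring pancakes l, r (l above r) an adjacency if r = l + 1
    and an anti-adjacency if r = l - 1; the plate below the stack is adjacent
    to n and anti-adjacent to -n. The stack -I_n has n anti-adjacencies and the
    sorted stack has n adjacencies.

    Lower bound. A flip of a prefix x ... a lying on b replaces the pair (a, b)
    by (-x, b), so it destroys at most one anti-adjacency and creates at most
    one adjacency, and the latter is impossible when x is anti-adjacent to the
    pancake below it. A flip that cuts a long run of anti-adjacencies normally
    brings such an x to the top, so the next flip creates no adjacency. The
    integer [potential] makes this precise: it rewards adjacencies, penalises
    pancakes inside runs of anti-adjacencies, and rewards a top pancake which
    can create an adjacency. One flip raises it by at most 2
    ([potential_turn]), while it is -(n + 1) on -I_n and 2n + 1 on I_n. Hence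
    2 T(n) >= 3n + 2 ([T_lower_bound]), which for odd n means
    T(n) >= (3n + 3) / 2.

    Upper bound. For n = 29 there is a word of 15 flips whose cube turns -I_29
    into I_29; these 45 flips meet the bound ([tour29]). Three of them, one in
    each copy of the word, cut the stack just above pancake 16, which is then
    seen as 16, -16 and 16 respectively; a sequence of flips with three such
    cuts is called a [tour] below.
    Pancake 16 can be replaced by five consecutive pancakes at the cost of six
    more flips: each of the three cuts above it, which merely turns the part of
    the stack above the cut, is replaced by three flips which do the same and
    in addition exchange the first two of the five pancakes with the next two;
    all other flips carry the five pancakes along as one. Three such exchanges,
    interleaved with the two half-turns that the group undergoes, take
    q+4, ..., q to q, ..., q+4. Moreover, among the nine new flips there are
    again three that cut just above pancake q, seen as q, -q, q, so that
    the step can be repeated ([tour_grow]): from n to n + 4 with six more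
    flips, that is, at the same rate as the lower bound. *)

Set Implicit Arguments.
Unset Strict Implicit.
Unset Printing Implicit Defensive.

Import Order.TTheory GRing.Theory Num.Theory.

(** * Turning over a prefix *)

Section Turn.

Local Open Scope ring_scope.

Implicit Types (x : int) (s t : seq int).

Definition turn s : seq int := [seq - x | x <- rev s].

Lemma turn2 x y : turn [:: x; y] = [:: - y; - x].
Proof. by []. Qed.

Lemma turn_cons x s : turn (x :: s) = rcons (turn s) (- x).
Proof. by rewrite /turn rev_cons map_rcons. Qed.

Lemma turn_rcons s x : turn (rcons s x) = - x :: turn s.
Proof. by rewrite /turn rev_rcons. Qed.

Lemma turn_belast x s : turn (x :: s) = - last x s :: turn (belast x s).
Proof. by rewrite lastI turn_rcons. Qed.

Lemma turn_cat s t : turn (s ++ t) = turn t ++ turn s.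
Proof. by rewrite /turn rev_cat map_cat. Qed.

Lemma turnK : involutive turn.
Proof. by elim=> // x s IH; rewrite turn_cons turn_rcons opprK IH. Qed.

Lemma size_turn s : size (turn s) = size s.
Proof. by rewrite size_map size_rev. Qed.

Lemma mem_turn x s : (x \in turn s) = (- x \in s).
Proof. by rewrite /turn -{1}[x]opprK mem_map ?mem_rev //; apply: oppr_inj. Qed.

Lemma flip_cat s t : flip (size s) (s ++ t) = turn s ++ t.
Proof. by rewrite /flip take_size_cat // drop_size_cat. Qed.

Lemma size_flip k s : size (flip k s) = size s.
Proof. by rewrite /flip size_cat size_map size_rev -size_cat cat_take_drop. Qed.

Lemma size_flips ks s : size (flips ks s) = size s.
Proof. by elim: ks s => //= k ks IH s; rewrite IH size_flip. Qed.

End Turn.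

(** * The entries of a stack *)

Section Stack.

Variable n : nat.

Lemma stack_range s y : is_stack n s -> y \in s -> 0 < `|y| <= n.
Proof.
move=> /perm_mem/(_ `|y|) + ys.
by rewrite mem_iota add1n ltnS map_f.
Qed.

Lemma stack0 s : is_stack n s -> 0%R \notin s.
Proof. by move=> st; apply/negP => /(stack_range st). Qed.

Lemma stack_size s : is_stack n s -> size s = n.
Proof. by move/perm_size; rewrite size_map size_iota. Qed.

Lemma stack_disjoint s t y z :
  is_stack n (s ++ t) -> y \in s -> z \in t -> `|y| != `|z|.
Proof.
move=> /perm_uniq; rewrite iota_uniq map_cat cat_uniq => /and3P[_ + _] ys zt.
apply: contra => /eqP eq_yz; apply/hasP.
by exists `|z|; [exact: map_f | rewrite -eq_yz; exact: map_f].
Qed.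

Lemma stack_away s y t z : is_stack n (s ++ y :: t) -> z \in s ++ t ->
  `|z| != `|y|.
Proof.
move=> /perm_uniq; rewrite iota_uniq map_cat map_cons uniq_catC /=.
move=> /andP[+ _].
rewrite -map_cat mem_cat orbC -mem_cat => + zst.
by apply: contra => /eqP <-; exact: map_f.
Qed.

Lemma flips_stack ks s : is_stack n s -> is_stack n (flips ks s).
Proof. by elim: ks s => //= k ks IH s /(flip_stack k)/IH. Qed.

End Stack.

(** * A potential that rises by at most two per flip *)

Section Potential.

Local Open Scope ring_scope.

Variable n : nat.

Implicit Types (s t : seq int) (l r x : int).

(** The plate is represented by 0, which is not the label of a pancake; it
    stands for both n + 1 and -(n + 1). *)
Definition adj l r : bool := if r == 0 then l == n%:Z else r == l + 1.

(** The plate is anti-adjacent to itself: the stack is followed by two copies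
    of the plate, so that -n on the plate is inside a run of anti-adjacencies
    and not at its end. *)
Definition anti l r : bool :=
  if r == 0 then (l == - n%:Z) || (l == 0) else r == l - 1.

(** The anti-adjacency between pancakes 1 and 2, which weighs more than the
    others because pancake 1 has a neighbour of consecutive label on one side
    only. *)
Definition one_clan l r : bool :=
  (l == 2) && (r == 1) || (l == -1) && (r == -2).

Fixpoint sum_pairs s : int :=
  if s is l :: t then
    (if t is r :: _ then 2 * (adj l r)%:Z - (one_clan l r)%:Z else 0)
    + sum_pairs t
  else 0.

Definition head_anti s : bool :=
  if s is l :: r :: _ then anti l r else false.

(** The number of entries that are anti-adjacent to both neighbours. *)
Fixpoint inner s : int :=
  if s is _ :: t then (head_anti s && head_anti t)%:Z + inner t else 0.

(** A top pancake x can create an adjacency only with 1 - x. This is out of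
    reach if x is anti-adjacent to the next pancake, which is then x - 1, and
    if x = 1; but a pancake 1 that lies on 2 is in its final position and is
    not penalised. *)
Definition free_top s : bool :=
  if s is x :: y :: _ then ~~ anti x y && ((x == 1) ==> adj x y) else false.

Definition potential s : int :=
  let t := s ++ [:: 0; 0] in sum_pairs t - inner t + (free_top t)%:Z.

Lemma adj_opp l r : l != 0 -> r != 0 -> adj (- r) (- l) = adj l r.
Proof. by rewrite /adj oppr_eq0 => /negPf-> /negPf->; lia. Qed.

Lemma anti_opp l r : l != 0 -> r != 0 -> anti (- r) (- l) = anti l r.
Proof. by rewrite /anti oppr_eq0 => /negPf-> /negPf->; lia. Qed.

Lemma one_clan_opp l r : one_clan (- r) (- l) = one_clan l r.
Proof. rewrite /one_clan; lia. Qed.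

Lemma sum_pairs_cat s a b t :
  sum_pairs (rcons s a ++ b :: t) =
  sum_pairs (rcons s a) + (2 * (adj a b)%:Z - (one_clan a b)%:Z)
  + sum_pairs (b :: t).
Proof.
elim: s => [|x s IH] //=; first by rewrite addr0 add0r.
by case: s IH => [|y s] /= ->; rewrite !addrA.
Qed.

Lemma sum_pairs_turn s : 0 \notin s -> sum_pairs (turn s) = sum_pairs s.
Proof.
elim: s => [|x [|y s] IH] //; rewrite inE negb_or eq_sym => /andP[x0 s0].
have y0 : y != 0 by move: s0; rewrite inE negb_or eq_sym => /andP[].
rewrite turn_cons -cats1 turn_cons sum_pairs_cat -turn_cons IH //.
by rewrite adj_opp // one_clan_opp addr0 addrC.
Qed.

Lemma head_anti_cat s t : (1 < size s)%N -> head_anti (s ++ t) = head_anti s.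
Proof. by case: s => [|x [|y s]]. Qed.

Lemma inner_cons x s :
  inner (x :: s) = (head_anti (x :: s) && head_anti s)%:Z + inner s.
Proof. by []. Qed.

Lemma inner_cat s a b t : 0 \notin rcons s a ->
  inner (rcons s a ++ b :: t) =
  inner (rcons s a) + (head_anti (turn (rcons s a)) && anti a b)%:Z
  + (anti a b && head_anti (b :: t))%:Z + inner (b :: t).
Proof.
elim: s => [|x s IH]; first by rewrite /= add0r.
rewrite rcons_cons inE negb_or eq_sym => /andP[x0 s0].
rewrite cat_cons !(inner_cons x) IH // turn_cons -!cat_cons -!rcons_cons.
case: s s0 {IH} => [|y s] s0.
  have a0 : a != 0 by move: s0; rewrite inE eq_sym.
  by rewrite /= andbF !add0r anti_opp // !addrA.
rewrite -[rcons _ (- x)]cats1.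
by rewrite !head_anti_cat ?size_turn ?size_rcons //= !addrA.
Qed.

Lemma inner_turn s : 0 \notin s -> inner (turn s) = inner s.
Proof.
elim: s => [|x [|y s] IH] //; rewrite inE negb_or eq_sym => /andP[x0 s0].
have y0 : y != 0 by move: s0; rewrite inE negb_or eq_sym => /andP[].
rewrite turn_cons -cats1 turn_cons inner_cat -?turn_cons ?IH ?turnK //;
  last by rewrite mem_turn oppr0.
by rewrite anti_opp //= andbF !addr0 addrC andbC.
Qed.

(** Only the pair (a, b) at the cut, which becomes (-x, b), and the top matter.
    An adjacency (-x, b) needs a free top, and then b is not followed by an
    anti-adjacency, since b - 1 = -x. If a was inside a run of
    anti-adjacencies, the new top -a is not free. Therefore the gain of 2 for
    an adjacency and the gains for the two ends a and b of a broken
    anti-adjacency never add up to more than 2. *)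
Lemma potential_turn s t : (1 < n)%N -> is_stack n (s ++ t) ->
  potential (turn s ++ t) <= potential (s ++ t) + 2.
Proof.
case: s => [|x s] n1; first by rewrite lerDl.
rewrite /potential -!catA.
have : t ++ [:: 0; 0] = head 0 t :: behead (t ++ [:: 0; 0]) by case: t.
set b := head 0 t; set t' := behead _ => -> st.
(* The neighbours of the cut and of the top: a is the last entry of the prefix,
   y is the second entry of the stack, and c follows b. *)
pose a := last x s; pose y := head b s; pose c := head 0 (behead t).
have a_last : last x s = a by [].
have x_s := mem_head x s.
have a_s : a \in x :: s by apply: mem_last.
have range z : z \in x :: s -> (0 < `|z| <= n)%N.
  by move=> zs; apply: stack_range st _; rewrite mem_cat zs.
have x_range := range x x_s.
have disj z w : z \in x :: s -> w \in t -> `|z|%N != `|w|%N.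
  exact: (stack_disjoint st).
have x_disj z : z \in s -> `|x|%N != `|z|%N.
  move=> zs; apply: (@stack_disjoint n [:: x] (s ++ t)) => //.
    exact: mem_head.
  by rewrite mem_cat zs.
have [s0 t0] : 0 \notin x :: s /\ 0 \notin t.
  by have := stack0 st; rewrite mem_cat negb_or => /andP[].
have b_t : b != 0 -> b \in t.
  by rewrite /b; case: (t) => //= z u _; exact: mem_head.
have c_t : c = 0 \/ c \in t.
  rewrite /c; case: (t) => [|? [|z u]]; [by left | by left | right].
  by rewrite inE mem_head orbT.
have y_s : s = [::] /\ y = b \/ y \in s.
  rewrite /y; case: (s) => [|z u]; [by left | right; exact: mem_head].
have x_a : x = a -> s = [::].
  move=> x_last; case E: s => [//|z u].
  have /x_disj : a \in s by rewrite /a E; exact: (mem_last z u).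
  by rewrite -x_last eqxx.
(* A stack of at least two pancakes has no prefix of size 1 that lies on the
   plate. *)
have b_neq0 : s = [::] -> b != 0.
  move=> s_nil; apply: contra t0 => /eqP <-.
  have := stack_size st; rewrite s_nil /b; case: (t) => [/=|z u _]; first lia.
  exact: mem_head.
have disj_b z : z \in x :: s -> b != 0 -> `|z|%N != `|b|%N.
  by move=> zs /b_t; apply: disj.
have disj_c z : z \in x :: s -> c != 0 -> `|z|%N != `|c|%N.
  move=> zs c_neq0; apply: disj => //.
  by case: c_t c_neq0 => // ->; rewrite eqxx.
have topE : free_top ((x :: s) ++ b :: t') =
    ~~ anti x y && ((x == 1) ==> adj x y).
  by rewrite /y; case: (s).
have headE : head_anti (b :: t') = anti b c.
  by rewrite /t' /b /c; case: (t) => [|? []].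
clearbody b c a y.
have adj_free : adj (- x) b -> free_top ((x :: s) ++ b :: t').
  rewrite topE; case: y_s => [[s_nil ->]|ys].
    move: (b_neq0 s_nil) (disj_b x x_s (b_neq0 s_nil)); rewrite /adj /anti.
    by case: eqVneq => //= b0 _; clear -b0; lia.
  have ys' : y \in x :: s by rewrite inE ys orbT.
  move: (range y ys') x_range (disj_b y ys'); rewrite /adj /anti.
  clear; case: (eqVneq b 0) => [->|b0] y_range x_rng.
    by case: (eqVneq y 0); lia.
  by move=> /(_ isT); case: (eqVneq y 0); lia.
have adj_end : adj (- x) b -> anti a b -> ~~ head_anti (b :: t').
  rewrite headE /adj /anti; case: (eqVneq b 0) => [b_eq0|b0].
    move=> xn an; have x_eq_a : x = a.
      by move: xn an (range a a_s); clear; lia.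
    by move: (b_neq0 (x_a x_eq_a)); rewrite b_eq0.
  move=> xb _; move: xb x_range (disj_c x x_s) b0; clear.
  case: (eqVneq c 0) => [_ | _] xb x_range; first by lia.
  by move=> /(_ isT); lia.
have adj_broken : adj a b -> ~~ adj (- x) b.
  move=> ab; apply/negP => xb; have x_neq_a : x != a.
    by move: ab xb x_range; rewrite /adj; clear; case: ifP; lia.
  have : `|x|%N != `|a|%N.
    by apply: x_disj; move: a_s; rewrite inE eq_sym (negPf x_neq_a).
  by move: ab xb; rewrite /adj; clear; case: ifP; lia.
have adj_anti : adj a b -> ~~ anti a b.
  by move: (range a a_s) n1; rewrite /adj /anti; clear; case: ifP; lia.
have run_top : head_anti (turn (x :: s)) ->
    ~~ free_top (turn (x :: s) ++ b :: t').
  by case: (turn _) => [|? [|? ?]] //= ->.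
(* Breaking the pair (2, 1) leaves no other gain at b = 1, and breaking
   (-1, -2) leaves none at the new top 1. *)
have one_broken : one_clan a b -> anti a b /\
  (~~ adj (- x) b && ~~ head_anti (b :: t') \/
   ~~ head_anti (turn (x :: s)) && ~~ free_top (turn (x :: s) ++ b :: t')).
  rewrite headE => /orP[] /andP[/eqP aE /eqP bE].
    split; first by rewrite aE bE.
    left; move: x_range n1; rewrite bE /adj /anti; clear => /=.
    by case: (eqVneq c 0) => [_|c0]; lia.
  split; first by rewrite aE bE.
  right; rewrite turn_belast a_last aE bE.
  have in_s z : z \in turn (belast x s) -> - z \in x :: s.
    by rewrite mem_turn; apply: mem_belast.
  case: (turn _) in_s => [|z u] // /(_ z (mem_head _ _)) zs.
  have := disj_b _ zs; have := range _ zs; rewrite bE /= /adj /anti; clear.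
  by case: (eqVneq z 0) => [-> //|z0] _ /(_ isT); lia.
have turnE : turn (x :: s) = rcons (turn s) (- x) by rewrite turn_cons.
have sE : x :: s = rcons (belast x s) a by rewrite -a_last -lastI.
rewrite {1 2}turnE {2 3}sE !sum_pairs_cat !inner_cat -?turnE -?sE //;
  last by rewrite mem_turn oppr0.
rewrite sum_pairs_turn // inner_turn // turnK.
move: run_top adj_free adj_end adj_broken adj_anti one_broken.
move: (adj _ _) (adj _ _) (anti _ _) (anti _ _) (one_clan _ _) (one_clan _ _).
move=> A1 A0 C1 C0 o1 o0.
move: (head_anti _) (head_anti _) (head_anti _) (free_top _) (free_top _).
move: (sum_pairs _) (sum_pairs _) (inner _) (inner _) => p1 p2 p3 p4.
clear.
by move=> [] [] [] [] []; case: C0; case: A0; case: A1; case: o0 => /=; lia.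
Qed.

Lemma potential_flips ks s : (1 < n)%N -> is_stack n s ->
  potential (flips ks s) <= potential s + 2 * (size ks)%:Z.
Proof.
move=> n1; elim: ks s => [|k ks IH] s st /=; first by rewrite addr0.
apply: le_trans (IH _ (flip_stack k st)) _.
have := @potential_turn (take k s) (drop k s) n1.
rewrite cat_take_drop => /(_ st); rewrite -/(flip k s); lia.
Qed.

Lemma burnt_tail j k : (0 < j)%N -> (j + k = n)%N ->
  let t := [seq - Posz i | i <- iota j k.+1] ++ [:: 0; 0] in
  [/\ head_anti t, sum_pairs t = - ((j == 1%N) && (0 < k)%N)%:Z
    & inner t = k.+1%:Z].
Proof.
elim: k j => [|k IH] j j0 jk.
  by split; rewrite /= /adj /anti /one_clan /=; lia.
have j1 : - Posz j.+1 == 0 = false by [].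
have [|| /= -> -> ->] := IH j.+1; [by [] | lia |].
have -> : anti (- Posz j) (- Posz j.+1) by rewrite /anti j1; lia.
have -> : adj (- Posz j) (- Posz j.+1) = false.
  by rewrite /adj j1; apply/negbTE; lia.
by rewrite /one_clan; split; lia.
Qed.

Lemma sorted_tail j k : (0 < j)%N -> (j + k = n)%N ->
  let t := [seq Posz i | i <- iota j k.+1] ++ [:: 0; 0] in
  [/\ ~~ head_anti t, sum_pairs t = 2 * k.+1%:Z & inner t = 0].
Proof.
elim: k j => [|k IH] j j0 jk.
  by split; rewrite /= /adj /anti /one_clan /=; lia.
have [|| /= /negPf-> -> ->] := IH j.+1; [by [] | lia |].
have /negPf-> : ~~ anti (Posz j) (Posz j.+1) by rewrite /anti /=; lia.
have -> : adj (Posz j) (Posz j.+1) by rewrite /adj /=; lia.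
by rewrite /one_clan; split; lia.
Qed.

End Potential.

Section LowerBound.

Local Open Scope ring_scope.

Lemma potential_burnt n : (1 < n)%N ->
  potential n (burnt_stack n) = - (n.+1)%:Z.
Proof.
case: n => [|[|n]] // _; rewrite /potential.
have [|| _ -> ->] := @burnt_tail n.+2 1 n.+1; [by []|lia|].
rewrite /= /anti; lia.
Qed.

Lemma potential_sorted n : (1 < n)%N ->
  potential n (sorted_stack n) = (2 * n).+1%:Z.
Proof.
case: n => [|[|n]] // _; rewrite /potential.
have [|| _ -> ->] := @sorted_tail n.+2 1 n.+1; [by []|lia|].
rewrite /= /anti /adj; lia.
Qed.

Lemma T_lower_bound n : (1 < n)%N -> (3 * n + 2 <= 2 * T n)%N.
Proof.
move=> n1; rewrite /T; case: ex_minnP => m /transforms_inP[ks [<- _ eq_n]] _.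
have := potential_flips ks n1 (burnt_stackP n).
rewrite eq_n potential_burnt // potential_sorted //; lia.
Qed.

End LowerBound.

(** * Reaching a stack from another one *)

Section Reach.

Implicit Types (m : nat) (s t u v : seq int).

Definition reach m s t : Prop :=
  exists ks,
    [/\ size ks <= m, all (fun k => 0 < k <= size s) ks & flips ks s = t].

Lemma reach_cat m1 m2 s t u :
  reach m1 s t -> reach m2 t u -> reach (m1 + m2) s u.
Proof.
move=> [ks1 [le1 ok1 <-]] [ks2 [le2 ok2 <-]]; exists (ks1 ++ ks2).
rewrite size_cat leq_add // all_cat ok1 flips_cat.
by move: ok2; rewrite size_flips => ->.
Qed.

(** An empty prefix is turned by no flip at all; this is why [reach] only
    bounds the number of flips. *)
Lemma reach_turn s t : reach 1 (s ++ t) (turn s ++ t).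
Proof.
case: s => [|x s]; first by exists [::].
exists [:: size (x :: s)]; split=> //; last by rewrite -flip_cat.
by rewrite /= size_cat ltnS leq_addr.
Qed.

Lemma reach_last m s t u v :
  reach m s (t ++ u) -> turn t ++ u = v -> reach (m + 1) s v.
Proof. by move=> st <-; apply: reach_cat st (reach_turn _ _). Qed.

Lemma reach_first m t u v :
  reach m (turn t ++ u) v -> reach (1 + m) (t ++ u) v.
Proof. by move=> tu; apply: reach_cat (reach_turn _ _) tu. Qed.

Lemma reach_stack n m s t : is_stack n s -> reach m s t -> is_stack n t.
Proof. by move=> st [ks [_ _ <-]]; apply: flips_stack. Qed.

Lemma T_le_reach n m : reach m (burnt_stack n) (sorted_stack n) -> T n <= m.
Proof.
move=> [ks [le_m ok eq_n]]; apply: leq_trans le_m.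
rewrite /T; case: ex_minnP => t _; apply; apply/transforms_inP; exists ks.
by split=> //; move: ok; rewrite /burnt_stack !size_map size_iota.
Qed.

End Reach.

(** * Replacing one pancake by a rigid group of pancakes *)

Section Expansion.

Local Open Scope ring_scope.

Variable q : nat.
Hypothesis q_gt0 : (0 < q)%N.

Implicit Types (y : int) (B s t : seq int).

Definition shift y : int :=
  if q%:Z < y then y + 4 else if y < - q%:Z then y - 4 else y.

Definition grow B y : seq int :=
  if y == q%:Z then B else if y == - q%:Z then turn B else [:: shift y].

(** Pancake q is replaced by the group B, whose orientation follows that of q;
    the other labels make room for five labels q, ..., q + 4. *)
Definition expand B s : seq int := flatten [seq grow B y | y <- s].

Lemma grow_opp B y : grow B (- y) = turn (grow B y).
Proof.
rewrite /grow eqr_opp eqr_oppLR.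
case: eqP => [->|_]; first by rewrite ifN ?turnK //; lia.
case: eqP => // _; rewrite /turn /=; congr [:: _].
by rewrite /shift ltrNr ltrN2; case: (ltP y) => yq; case: (ltP _ y) => qy; lia.
Qed.

Lemma expand_cat B s t : expand B (s ++ t) = expand B s ++ expand B t.
Proof. by rewrite /expand map_cat flatten_cat. Qed.

Lemma expand_turn B s : expand B (turn s) = turn (expand B s).
Proof.
elim: s => // y s IH; rewrite turn_cons -cats1 expand_cat IH.
by rewrite [expand B (y :: s)]/= turn_cat /expand /= cats0 grow_opp.
Qed.

Lemma expand_q B s t :
  expand B (s ++ q%:Z :: t) = expand B s ++ B ++ expand B t.
Proof. by rewrite expand_cat /expand /= /grow eqxx. Qed.

Lemma expand_Nq B s t :
  expand B (s ++ - q%:Z :: t) = expand B s ++ turn B ++ expand B t.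
Proof. by rewrite expand_cat /expand /= grow_opp /grow eqxx. Qed.

Lemma expand_away B s : {in s, forall y, `|y|%N != q} ->
  expand B s = [seq shift y | y <- s].
Proof.
elim: s => // y s IH away; rewrite /expand /= -/(expand B s) IH; last first.
  by move=> z zs; apply: away; rewrite inE zs orbT.
have := away y (mem_head _ _).
by rewrite /grow => yq; rewrite !ifN //; lia.
Qed.

(** A flip that does not cut inside the group treats it as one pancake. *)
Lemma reach_expand B m s t :
  reach m s t -> reach m (expand B s) (expand B t).
Proof.
move=> [ks [+ + <-]]; elim: ks m s => [|k ks IH] m s.
  by move=> _ _; exists [::].
case: m => // m le_m /andP[_ ok].
rewrite -add1n; apply: reach_cat (IH m (flip k s) le_m _).
  rewrite /flip -/(turn _) expand_cat expand_turn.
  rewrite -{1}(cat_take_drop k s) expand_cat.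
  exact: reach_turn.
by rewrite size_flip.
Qed.

Lemma expand_iota (e : bool) B n : (q <= n)%N ->
  let f (i : nat) : int := if e then - i%:Z else i%:Z in
  grow B (f q) = [seq f i | i <- iota q 5] ->
  expand B [seq f i | i <- iota 1 n] = [seq f i | i <- iota 1 (n + 4)].
Proof.
move=> q_n f f_q.
have f_abs i : `|f i|%N = i by rewrite /f; case: (e); lia.
have split_iota k : iota 1 (q.-1 + (k + (n - q))) =
    iota 1 q.-1 ++ iota q k ++ iota (q + k) (n - q).
  by rewrite !iotaD add1n prednK.
have -> : n = (q.-1 + (1 + (n - q)))%N by lia.
have -> : (q.-1 + (1 + (n - q)) + 4 = q.-1 + (5 + (n - q)))%N by lia.
rewrite !split_iota !map_cat !expand_cat.
rewrite ![expand _ [seq f i | i <- iota _ (_ - _)]]expand_away //; last first.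
  by move=> _ /mapP[i + ->]; rewrite mem_iota f_abs; lia.
rewrite [expand _ [seq f i | i <- iota _ (_.-1)]]expand_away //; last first.
  by move=> _ /mapP[i + ->]; rewrite mem_iota f_abs; lia.
rewrite -f_q /expand /= cats0; congr (_ ++ (_ ++ _)).
  rewrite -map_comp; apply/eq_in_map => i; rewrite mem_iota /= /shift /f => i_q.
  by case: (e); rewrite !ifN //; lia.
have -> : (q + 5 = 4 + (q + 1))%N by lia.
rewrite [iota (4 + _) _]iotaDl -!map_comp; apply/eq_in_map => i.
rewrite mem_iota /= /shift /f => i_q.
case: (e); last by rewrite ifT; lia.
by rewrite ifN 1?ifT; lia.
Qed.

Lemma expand_sorted n : (q <= n)%N ->
  expand [seq i%:Z | i <- iota q 5] (sorted_stack n) =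
  sorted_stack (n + 4).
Proof. by move=> q_n; rewrite (@expand_iota false) // /grow eqxx. Qed.

Lemma expand_burnt n : (q <= n)%N ->
  expand (rev [seq i%:Z | i <- iota q 5]) (burnt_stack n) =
  burnt_stack (n + 4).
Proof.
move=> q_n; rewrite (@expand_iota true) // grow_opp /grow eqxx.
by rewrite /turn revK -map_comp.
Qed.

End Expansion.

(** * Tours and their growth *)

Section Tour.

Local Open Scope ring_scope.

Variable q : nat.

(** Sequences of at most m flips from -I_n to I_n in which three flips, those
    that turn X1, X2 and X3, cut the stack just above pancake q, the second
    time upside down. *)
Variant tour (n m : nat) : Prop :=
  Tour a b c d X1 Y1 X2 Y2 X3 Y3 of
    reach a (burnt_stack n) (X1 ++ q%:Z :: Y1)
  & reach b (turn X1 ++ q%:Z :: Y1) (X2 ++ - q%:Z :: Y2)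
  & reach c (turn X2 ++ - q%:Z :: Y2) (X3 ++ q%:Z :: Y3)
  & reach d (turn X3 ++ q%:Z :: Y3) (sorted_stack n)
  & (a + b + c + d + 3 <= m)%N.

Lemma T_le_tour n m : tour n m -> (T n <= m)%N.
Proof.
case=> a b c d X1 Y1 X2 Y2 X3 Y3 ra rb rc rd le_m.
apply: leq_trans le_m; apply: T_le_reach.
have -> : (a + b + c + d + 3 = a + (1 + (b + (1 + (c + (1 + d))))))%N by lia.
apply: reach_cat ra (reach_first _); apply: reach_cat rb (reach_first _).
by apply: reach_cat rc (reach_first _).
Qed.

(** The group that replaces q passes through four internal orders, written x4,
    x3, x2, x1, x0 for labels q + 4, ..., q: between the cuts it is carried
    along rigidly ([reach_expand]), and at each cut three flips turn the part X
    above the group and exchange the first two pancakes of the group with the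
    next two, as seen from the top. The three cuts of the new tour are the
    second, the third and the first flip, respectively, of these triples. *)
Lemma tour_grow n m : (0 < q <= n)%N -> tour n m -> tour (n + 4) (m + 6).
Proof.
move=> /andP[q_gt0 q_n] [a b c d X1 Y1 X2 Y2 X3 Y3 ra rb rc rd le_m].
have st1 := reach_stack (burnt_stackP n) ra.
have st2 := reach_stack (reach_stack st1 (reach_turn X1 _)) rb.
have st3 := reach_stack (reach_stack st2 (reach_turn X2 _)) rc.
have awayE B s y t : is_stack n (s ++ y :: t) -> `|y|%N = q ->
    expand q B s = map (shift q) s /\ expand q B t = map (shift q) t.
  move=> st yq; split; apply: expand_away => // z zs; rewrite -yq;
    by apply: (stack_away st); rewrite mem_cat zs ?orbT.
have Nq_abs : `|- q%:Z|%N = q by rewrite abszN.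
pose x i : int := (q + i)%:Z.
have x0 : q%:Z = x 0 by rewrite /x addn0.
have xE : [seq i%:Z | i <- iota q 5] = [:: x 0; x 1; x 2; x 3; x 4].
  by rewrite /x !addnS !addn0.
have := expand_burnt q_gt0 q_n; rewrite xE => burntE.
have := expand_sorted q_gt0 q_n; rewrite xE => sortedE.
have {ra} := reach_expand q_gt0 [:: x 4; x 3; x 2; x 1; x 0] ra.
have {rb} := reach_expand q_gt0 [:: x 2; x 1; x 4; x 3; x 0] rb.
have {rc} := reach_expand q_gt0 [:: x 2; x 3; x 0; x 1; x 4] rc.
have {rd} := reach_expand q_gt0 [:: x 0; x 1; x 2; x 3; x 4] rd.
rewrite burntE sortedE !expand_q !expand_Nq // !expand_turn //.
have X1E B := (awayE B _ _ _ st1 erefl).1.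
have Y1E B := (awayE B _ _ _ st1 erefl).2.
have X2E B := (awayE B _ _ _ st2 Nq_abs).1.
have Y2E B := (awayE B _ _ _ st2 Nq_abs).2.
have X3E B := (awayE B _ _ _ st3 erefl).1.
have Y3E B := (awayE B _ _ _ st3 erefl).2.
rewrite !X1E !Y1E !X2E !Y2E !X3E !Y3E.
clear -le_m x0.
move: (map _ X1) (map _ Y1) (map _ X2) (map _ Y2) (map _ X3) (map _ Y3).
move=> {}X1 {}Y1 {}X2 {}Y2 {}X3 {}Y3 rd rc rb ra.
pose N1 := [:: - x 3; - x 4] ++ turn X1 ++ [:: x 2; x 1].
pose N2 := [:: x 1; x 4] ++ X2.
pose N3 := X3 ++ [:: x 2; x 3].
apply: (@Tour _ _ (a + 1) (1 + b + 1 + 1) c (1 + (1 + d)) N1 Y1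
  N2 ([:: - x 3; - x 2] ++ Y2) N3 ([:: x 1; x 4] ++ Y3));
  rewrite ?x0; last by lia.
- apply: (@reach_last _ _ (X1 ++ [:: x 4; x 3]) ([:: x 2; x 1; x 0] ++ Y1)).
    by rewrite -catA.
  by rewrite turn_cat -!catA.
- have -> : turn N1 ++ x 0 :: Y1 =
      ([:: - x 1; - x 2] ++ X1) ++ [:: x 4; x 3; x 0] ++ Y1.
    by rewrite !turn_cat turnK !turn2 !opprK -!catA.
  apply: (@reach_last _ _ ([:: x 3; x 0] ++ turn X2 ++ [:: - x 4; - x 1])
    ([:: - x 2] ++ Y2)); last by rewrite !turn_cat turnK !turn2 !opprK -!catA.
  apply: (@reach_last _ _ (X2 ++ [:: - x 0; - x 3])
    ([:: - x 4; - x 1; - x 2] ++ Y2)).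
    apply: (@reach_first _ ([:: - x 1; - x 2] ++ X1)).
    by rewrite turn_cat turn2 !opprK -!catA.
  by rewrite turn_cat turn2 !opprK -!catA.
- by rewrite /N2 /N3 turn_cat turn2 -!catA.
- have -> : turn N3 ++ x 0 :: [:: x 1; x 4] ++ Y3 =
      ([:: - x 3; - x 2] ++ turn X3 ++ [:: x 0; x 1]) ++ [:: x 4] ++ Y3.
    by rewrite turn_cat turn2 -!catA.
  apply: (@reach_first _ ([:: - x 3; - x 2] ++ turn X3 ++ [:: x 0; x 1])).
  rewrite !turn_cat turnK !turn2 !opprK.
  have -> : (([:: - x 1; - x 0] ++ X3) ++ [:: x 2; x 3]) ++ [:: x 4] ++ Y3 =
      ([:: - x 1; - x 0] ++ X3) ++ [:: x 2; x 3; x 4] ++ Y3.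
    by rewrite -!catA.
  apply: (@reach_first _ ([:: - x 1; - x 0] ++ X3)).
  by rewrite turn_cat turn2 !opprK -!catA.
Qed.

End Tour.

(** The word 24 4 12 28 14 6 24 16 4 20 6 26 4 16 29, three times over; the three
    cuts above pancake 16 are the second flips of size 24 in the copies. *)
Lemma tour29 : tour 16 29 45.
Proof.
pose ks1 := [:: 24; 4; 12; 28; 14; 6].
pose ks2 := [:: 16; 4; 20; 6; 26; 4; 16; 29; 24; 4; 12; 28; 14; 6].
pose ks3 := [:: 16; 4; 20; 6; 26; 4; 16; 29].
pose s1 := flips ks1 (burnt_stack 29).
pose s2 := flips (24 :: ks2) s1.
pose s3 := flips (24 :: ks2) s2.
apply: (@Tour 16 29 45 6 14 14 8 (take 24 s1) (drop 25 s1)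
  (take 24 s2) (drop 25 s2) (take 24 s3) (drop 25 s3)); last by [].
- by exists ks1; split; vm_compute.
- by exists ks2; split; vm_compute.
- by exists ks2; split; vm_compute.
- by exists ks3; split; vm_compute.
Qed.

Theorem theorem4 (n : nat) (n_ge29 : 29 <= n) (n_mod4 : n = 1 %[mod 4]) :
  ((T n)%:R = 3%:R / 2%:R * n%:R + 3%:R / 2%:R :> rat)%R.
Proof.
have [k n_k] : exists k, n = 29 + 4 * k.
  by exists ((n - 29) %/ 4); move: n_mod4; lia.
have tour_k : tour 16 n (45 + 6 * k).
  rewrite {}n_k; elim: k => [|k IH]; first exact: tour29.
  have -> : 29 + 4 * k.+1 = 29 + 4 * k + 4 by lia.
  have -> : 45 + 6 * k.+1 = 45 + 6 * k + 6 by lia.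
  by apply: tour_grow => //; lia.
have upper := T_le_tour tour_k.
have lower : 3 * n + 2 <= 2 * T n by apply: T_lower_bound; lia.
have T_n : 2 * T n = 3 * n + 3 by lia.
have := congr1 (fun i => i%:R : rat)%R T_n.
by rewrite natrD !natrM; lra.
Qed.
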